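(* If $\Omega=\{\omega_1,\ldots,\omega_M\}$ is an LF-inducing set, then the two-sided Mahavier product $I_{F_\Omega}$ is a Lelek fan.
   Context: $I=[0,1]$. For a closed relation $F\subseteq X\times X$ on a compact metric space $X$, the two-sided Mahavier product is $X_F=\{(x_i)_{i\in\mathbb Z}\in X^{\mathbb Z}: (x_i,x_{i+1})\in F \text{ for every } i\in\mathbb Z\}$, with the topology inherited from the product topology. $(r,\rho)\in\mathcal{NC}$ (''$r$ and $\rho$ never connect'') means: $0<r<1<\rho$, and for all integers $k,l$, $r^k=\rho^l$ if and only if $k=l=0$. For an integer $M\ge 2$, a set $\Omega=\{\omega_1,\ldots,\omega_M\}$ of positive real numbers is LF-inducing if $\omega_1<1<\omega_2$ and $(\omega_1,\omega_2)\in\mathcal{NC}$. For such $\Omega$, $F_\Omega=\bigcup_{j=1}^M\{(x,y)\in I^2: y=\omega_j x\}$. A continuum is a nonempty compact connected metric space. A fan is an arcwise connected, hereditarily unicoherent continuum with exactly one ramification point (its top $v$). It is smooth if whenever $x_n\to x$, the unique arcs from $v$ to $x_n$ converge in the Hausdorff metric to the unique arc from $v$ to $x$. An endpoint is a point that is an endpoint of every arc containing it. A Lelek fan is a smooth fan whose set of endpoints is dense (it is unique up to homeomorphism). *)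

(* Defs.v *)
From HB Require Import structures.
From mathcomp Require Export all_boot all_order all_algebra.
From mathcomp Require Export all_classical all_reals all_analysis.

Set Implicit Arguments.
Unset Strict Implicit.
Unset Printing Implicit Defensive.

Export Order.TTheory GRing.Theory Num.Theory.
Export numFieldNormedType.Exports.

Local Open Scope classical_set_scope.
Local Open Scope ring_scope.

(* Spaces are represented as subsets of an ambient topological space, with the
   inherited topology. *)

Definition homeomorphism (S T : topologicalType) (A : set S) (B : set T)
    (f : S -> T) : Prop :=
  [/\ set_fun A B f, {within A, continuous f} &
      exists g : T -> S, [/\ set_fun B A g, {within B, continuous g},
        (forall x, A x -> g (f x) = x) & (forall y, B y -> f (g y) = y)]].

Definition unit_interval (R : realType) : set R := `[0, 1].

Section Continua.
Variables (R : realType) (T : topologicalType).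
Implicit Types (d : T -> T -> R) (A B C Y : set T) (x y z v : T).

(* Only the values of d on A matter. The last clause says that the balls of d
   generate the topology A inherits from T; this is why d is not given by a
   metricType structure, which would concern the whole carrier T. *)
Definition compatible_metric d A : Prop :=
  [/\ (forall x y, A x -> A y -> 0 <= d x y),
      (forall x y, A x -> A y -> d x y = 0 <-> x = y),
      (forall x y, A x -> A y -> d x y = d y x),
      (forall x y z, A x -> A y -> A z -> d x z <= d x y + d y z) &
      (forall x, A x -> forall U : set T, within A (nbhs x) U <->
         exists2 e : R, 0 < e & forall y, A y -> d x y < e -> U y)].

Definition continuum d A : Prop :=
  [/\ A !=set0, compatible_metric d A, compact A & connected A].

Definition arc_from_to B x y : Prop :=
  exists f : R -> T, [/\ homeomorphism (@unit_interval R) B f, f 0 = x & f 1 = y].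

Definition is_arc B : Prop := exists f : R -> T, homeomorphism (@unit_interval R) B f.

Definition arc_endpoint B x : Prop := exists y, arc_from_to B x y.

Definition arcwise_connected A : Prop :=
  forall x y, A x -> A y -> x <> y -> exists2 B, B `<=` A & arc_from_to B x y.

Definition unicoherent d A : Prop :=
  forall B C, continuum d B -> continuum d C -> A = B `|` C ->
    connected (B `&` C).

Definition hereditarily_unicoherent d A : Prop :=
  forall B, B `<=` A -> continuum d B -> unicoherent d B.

Definition triod_model : set (R * R) :=
  [set p | (-1 <= p.1 <= 1 /\ p.2 = 0) \/ (p.1 = 0 /\ 0 <= p.2 <= 1)].

Definition simple_triod_with_top Y v : Prop :=
  exists f : R * R -> T, homeomorphism triod_model Y f /\ f (0, 0) = v.

Definition ramification_points A : set T :=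
  [set v | exists2 Y, Y `<=` A & simple_triod_with_top Y v].

Definition fan d A : Prop :=
  [/\ continuum d A, arcwise_connected A, hereditarily_unicoherent d A &
      exists v, ramification_points A = [set v]].

Definition hausdorff_distance d B C : R :=
  inf [set e : R | [/\ 0 < e,
    (forall x, B x -> exists2 y, C y & d x y < e) &
    (forall y, C y -> exists2 x, B x & d x y < e)]].

(* The arc in A from v to x, where the arc from v to itself is {v}. *)
Definition arc_in A v x B : Prop :=
  B `<=` A /\ ((v = x /\ B = [set v]) \/ (v <> x /\ arc_from_to B v x)).

Definition smooth d A v : Prop :=
  forall (x_ : nat -> T) (x : T), (forall n, A (x_ n)) -> A x ->
    x_ n @[n --> \oo] --> x ->
  forall (B_ : nat -> set T) (B : set T),
    (forall n, arc_in A v (x_ n) (B_ n)) -> arc_in A v x B ->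
    hausdorff_distance d (B_ n) B @[n --> \oo] --> (0 : R).

Definition smooth_fan d A : Prop :=
  fan d A /\ forall v, ramification_points A v -> smooth d A v.

Definition endpoints A : set T :=
  [set x | A x /\ forall B, B `<=` A -> is_arc B -> B x -> arc_endpoint B x].

End Continua.

Definition Lelek_fan (R : realType) (T : topologicalType) (A : set T) : Prop :=
  exists d : T -> T -> R, smooth_fan d A /\ A `<=` closure (endpoints R A).

Definition mahavier_product (T : topologicalType) (X : set T)
    (F : set (T * T)) : set {ptws int -> T} :=
  [set x | (forall i : int, X (x i)) /\ forall i : int, F (x i, x (i + 1))].

Definition never_connect (R : realType) (r rho : R) : Prop :=
  [/\ 0 < r < 1, 1 < rho &
      forall k l : int, r ^ k = rho ^ l <-> k = 0 /\ l = 0].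

(* The enumeration omega_1, ..., omega_M is indexed from 0. *)
Definition LF_inducing (R : realType) (M : nat) (Omega : M.-tuple R) : Prop :=
  [/\ (2 <= M)%N, (forall w, w \in Omega -> 0 < w),
      Omega`_0 < 1 < Omega`_1 & never_connect Omega`_0 Omega`_1].

Definition F_of (R : realType) (M : nat) (Omega : M.-tuple R) : set (R * R) :=
  [set p | [/\ unit_interval p.1, unit_interval p.2 &
               exists2 w, w \in Omega & p.2 = w * p.1]].

(* Main.v *)
(** A nonzero point x of the product is determined by x_0 and by the ratios
    x_{i+1} / x_i, which range over the finite set Omega; hence the product is a
    union of segments {a x : 0 <= a <= 1}, and segments in different directions
    meet only at the constant sequence 0.
    A closed connected subset that contains x but not a x (0 <= a < 1) lies in
    the open ray {b x : b > a}, because prescribing finitely many ratios is a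
    clopen condition away from 0. This single fact yields hereditary
    unicoherence, the uniqueness of arcs from 0 (hence smoothness), that 0 is
    the only ramification point, and that every x with sup x_i = 1 is an
    endpoint. Such points are dense: the products p^k q^l of the two
    multiplicatively independent letters p < 1 < q come arbitrarily
    close to 1, so the tail of x can be rerouted to approach 1 from below, and a small rescaling makes
    the supremum exactly 1. *)
Require Import Defs.
From mathcomp Require Import all_boot all_order all_algebra.
From mathcomp Require Import all_classical all_reals all_analysis.
From mathcomp Require Import lra ring zify.

Set Implicit Arguments.
Unset Strict Implicit.
Unset Printing Implicit Defensive.

Import Order.TTheory GRing.Theory Num.Theory.
Import numFieldNormedType.Exports.

Local Open Scope classical_set_scope.
Local Open Scope ring_scope.

(** * Homeomorphisms and arcs *)

Lemma compact_inj_homeomorphism (S T : topologicalType) (K : set S) (f : S -> T) :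
  S -> hausdorff_space T -> compact K -> {within K, continuous f} ->
  {in K &, injective f} -> homeomorphism K (f @` K) f.
Proof.
move=> s0 hT cK cf fI.
pose g (y : T) : S := xget s0 [set x | K x /\ f x = y].
have gK x : K x -> g (f x) = x.
  move=> Kx; rewrite /g; case: xgetP => [x' _ [Kx' e]|/(_ x)[]//].
  by apply: fI; rewrite ?inE.
clearbody g.
split=> [x Kx||]; [by exists x|by []|exists g; split=> [_ [x Kx <-]||x Kx|_ [x Kx <-]]].
- by rewrite gK.
- apply/continuous_closedP => Z cZ; apply/closed_subspaceP.
  exists (f @` (K `&` Z)).
    apply: compact_closed => //; apply: continuous_compact.
      exact: (continuous_subspaceW _ cf).
    exact: compact_closedI.
  apply/seteqP; split.
    by move=> _ [[x [Kx Zx] <-] fKx]; split=> //; rewrite /preimage/from_subspace/= gK.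
  move=> y [Zy [x Kx xy]]; split; exists x => //; split=> //.
  by move: Zy; rewrite -xy /preimage/from_subspace/= gK.
- exact: gK.
- by rewrite gK.
Qed.

Lemma within_continuous_precomp (S S' T : topologicalType) (K : set S) (K' : set S')
    (h : S' -> S) (f : S -> T) :
  continuous h -> (forall s, K' s -> K (h s)) -> {within K, continuous f} ->
  {within K', continuous (f \o h)}.
Proof.
move=> ch hK /continuous_closedP cf; apply/continuous_closedP => Z cZ.
have /closed_subspaceP[V cV VE] := cf _ cZ.
apply/closed_subspaceP; exists (h @^-1` V).
  by apply: preimage_closed => // s _; exact: ch.
apply/seteqP; split=> s [hs K's]; split=> //.
  by have [] : (from_subspace K f @^-1` Z `&` K) (h s) by rewrite -VE; split=> //; exact: hK.
by have [] : (V `&` K) (h s) by rewrite VE; split=> //; exact: hK.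
Qed.

Lemma arc_from_to_sym (R : realType) (T : topologicalType) (B : set T) x y :
  arc_from_to R B x y -> arc_from_to R B y x.
Proof.
move=> [f [[fB cf [g [gI cg gf fg]]] f0 f1]].
have flip r : @unit_interval R r -> @unit_interval R (1 - r).
  by rewrite /unit_interval/= !in_itv/=; lra.
have cflip : continuous (fun r : R => 1 - r).
  by move=> r; apply: cvgB; [exact: cvg_cst|exact: cvg_id].
exists (fun r => f (1 - r)); rewrite subr0 subrr; split=> //; split.
- by move=> r /flip/fB.
- exact: within_continuous_precomp cf.
- exists (fun z => 1 - g z); split.
  + by move=> z /gI/flip.
  + apply: (@within_continuous_comp _ _ _ B g (fun r : R => 1 - r)) cg.
    by move=> r _; exact: cflip.
  + by move=> r /flip rI; rewrite gf// subKr.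
  + by move=> z Bz; rewrite subKr fg.
Qed.

Lemma homeomorphism_inj (S T : topologicalType) (K : set S) (B : set T) (f : S -> T) s t :
  homeomorphism K B f -> K s -> K t -> f s = f t -> s = t.
Proof. by move=> [_ _ [g [_ _ gf _]]] Ks Kt e; rewrite -(gf s)// e gf. Qed.

Lemma homeomorphism_surj (S T : topologicalType) (K : set S) (B : set T) (f : S -> T) y :
  homeomorphism K B f -> B y -> exists2 s, K s & f s = y.
Proof. by move=> [_ _ [g [gBK _ _ fg]]] By; exists (g y); [exact: gBK|exact: fg]. Qed.

Lemma homeomorphism_image (S T : topologicalType) (K : set S) (B : set T) (f : S -> T) :
  homeomorphism K B f -> f @` K = B.
Proof.
move=> Hf; apply/seteqP; split=> [_ [s Ks <-]|y /(homeomorphism_surj Hf)[s Ks <-]].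
  by case: Hf => + _ _; apply.
by exists s.
Qed.

(** * The product space and its metric *)

Section Pointwise.
Variable R : realType.
Local Notation T := {ptws int -> R}.

Lemma hausdorff_ptws : hausdorff_space T.
Proof. by apply: hausdorff_product => i; exact: norm_hausdorff. Qed.

(** The pointwise topology is the supremum of the topologies induced by the coordinates, so
    convergence can be tested on each of them. *)
Lemma cvg_ptws (F : set_system T) (x : T) : Filter F ->
  (forall i, (fun y : T => y i) @ F --> x i) -> F --> x.
Proof.
move=> FF h.

have surj i : (fun y : T => y i) @` setT = setT.
  by apply/seteqP; split=> // r _; exists (fun=> r).
apply/cvg_sup => i; apply/cvg_image; first exact: surj.
move=> W /(h i) FW; exists ((fun y : T => y i) @^-1` W) => //.
by apply: image_preimage; exact: surj.
Qed.

Lemma ptws_coord_continuous (i : int) : continuous (fun x : T => x i).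
Proof. exact: (@proj_continuous int (fun=> R) i). Qed.

Lemma continuous_ptws (S : topologicalType) (f : S -> T) :
  (forall i, continuous (fun s => f s i)) -> continuous f.
Proof.
move=> cf s; apply: cvg_ptws => i.
exact: cf.
Qed.



(** Filters are closed under finite intersections; the window of integers is covered by two copies
    of ['I_n], one for each sign. *)
Lemma near_forall_int (S : Type) (F : set_system S) (P : int -> S -> Prop)
    (n : nat) {FF : Filter F} :
  (forall i, \forall s \near F, P i s) ->
  \forall s \near F, forall i : int, (`|i| < n)%N -> P i s.
Proof.
move=> FP.
have Fp : \forall s \near F, forall k : 'I_n, P (Posz k) s by exact: filter_forall.
have Fm : \forall s \near F, forall k : 'I_n, P (- Posz k) s by exact: filter_forall.
near=> s => -[k|k] kn; first exact: (near Fp s _ (Ordinal kn)).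
by rewrite NegzE; exact: (near Fm s _ (Ordinal kn)).
Unshelve. all: by end_near.
Qed.

Definition cube : set T := [set x | forall i, 0 <= x i <= 1].

(** The weights tend to 0 as the index grows, so on the cube smallness of [dist] depends on finitely
    many coordinates only, as the product topology demands. *)
Definition dist (x y : T) : R :=
  sup [set `|x i - y i| / `|i|%N.+1%:R | i in [set: int]].

Lemma dist_leP (x y : T) (e : R) : cube x -> cube y ->
  dist x y <= e <-> forall i, `|x i - y i| <= e * `|i|%N.+1%:R.
Proof.
move=> Qx Qy; split=> [h i|h].
  rewrite -ler_pdivrMr ?ltr0n//; apply: le_trans h; apply: ub_le_sup; last by exists i.
  exists 1 => _ [j _ <-]; rewrite ler_pdivrMr ?ltr0n// mul1r.
  apply: (@le_trans _ _ 1); last by rewrite ler1n.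
  by rewrite ler_norml; have := Qx j; have := Qy j; lra.
apply: ge_sup; first by exists (`|x 0 - y 0| / `|0|%N.+1%:R), 0.
by move=> _ [j _ <-]; rewrite ler_pdivrMr ?ltr0n.
Qed.

Lemma dist_ge0 (x y : T) : cube x -> cube y -> 0 <= dist x y.
Proof.
move=> Qx Qy; have /(dist_leP _ Qx Qy)/(_ 0) := lexx (dist x y).
by rewrite mulr1; apply: le_trans.
Qed.

Lemma dist_lt_window (e : R) : 0 < e ->
  exists n, forall x y : T, cube x -> cube y ->
    (forall i : int, (`|i| < n)%N -> `|x i - y i| <= e / 2) -> dist x y < e.
Proof.
(* Here [n > 2 / e]: beyond the window the coordinates differ by at most 1, which is below [e / 2]
   times the weight [|i| + 1]. The factor 2 turns the bound on the supremum into a strict one. *)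
move=> e0; pose n := (Num.trunc (2 / e)).+1.
have ne : 1 <= e / 2 * n%:R.
  rewrite mulrC -ler_pdivrMr ?divr_gt0// mul1r invf_div ltW//.
  exact: truncnS_gt.
clearbody n; exists n => x y Qx Qy h.
apply: (@le_lt_trans _ _ (e / 2)); last by rewrite ltr_pdivrMr ?ltr_pMr ?ltr1n.
apply/dist_leP => // i; have [/h xy|ni] := ltnP `|i| n.
  by apply: (le_trans xy); rewrite ler_pMr ?divr_gt0// ler1n.
apply: (@le_trans _ _ 1).
  by rewrite ler_norml; have := Qx i; have := Qy i; lra.
apply: (le_trans ne); rewrite ler_pM2l ?divr_gt0// ler_nat.
exact: leqW.
Qed.

Lemma dist_lt_near (x : T) (e : R) : cube x -> 0 < e ->
  \forall y \near x, cube y -> dist x y < e.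
Proof.
move=> Qx e0; have [n nP] := dist_lt_window e0.
have xnear : \forall y \near x, forall i : int, (`|i| < n)%N -> `|x i - y i| <= e / 2.
  apply: (@near_forall_int _ (nbhs x) (fun i (y : T) => `|x i - y i| <= e / 2) n) => i.
  have /cvgrPdist_le := @ptws_coord_continuous i x; apply.
  by rewrite divr_gt0.
near=> y => Qy; apply: nP => //; near: y.
exact: xnear.
Unshelve. all: by end_near.
Qed.

Lemma nbhs_dist_lt (x : T) (U : set T) : cube x -> nbhs x U ->
  exists2 e : R, 0 < e & forall y, cube y -> dist x y < e -> U y.
Proof.
move=> Qx xU.
(* The balls around [x] generate a filter that converges to [x] in each coordinate, hence contains
   every neighbourhood of [x]. *)
pose F := filter_from [set e : R | 0 < e] (fun e => [set y | cube y -> dist x y < e]).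
have FF : Filter F.
  apply: filter_from_filter; first by exists 1 => /=.
  move=> a b /= a0 b0; exists (Num.min a b); first by rewrite /= lt_min a0.
  by move=> y /= h; split=> Qy; move: (h Qy); rewrite lt_min => /andP[].
pose G := within cube F.
have : G --> x.
  apply: cvg_ptws => i; apply/cvgrPdist_lt => e e0.
  exists (e / `|i|%N.+1%:R); first by rewrite /= divr_gt0.
  move=> y /= h Qy; have /(_ i) := (dist_leP (dist x y) Qx Qy).1 (lexx _).
  by move/le_lt_trans; apply; rewrite -ltr_pdivlMr ?ltr0n//; exact: h.
move=> /(_ _ xU) [e e0 h]; exists e => // y Qy xy; exact: h.
Qed.

Lemma compatible_metric_dist (A : set T) : A `<=` cube -> compatible_metric dist A.
Proof.
move=> AQ; split.
- by move=> x y /AQ Qx /AQ Qy; exact: dist_ge0.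
- move=> x y /AQ Qx /AQ Qy; split=> [e|->].
    apply/funext => i; have := (dist_leP 0 Qx Qy).1; rewrite e lexx => /(_ isT i).
    by rewrite mul0r normr_le0 subr_eq0 => /eqP.
  apply/eqP; rewrite eq_le dist_ge0// andbT; apply/dist_leP => // i.
  by rewrite subrr normr0 mul0r.
- move=> x y _ _; rewrite /dist; congr (sup _); apply/eq_imagel => i _.
  by rewrite distrC.
- move=> x y z /AQ Qx /AQ Qy /AQ Qz; apply/dist_leP => // i.
  rewrite mulrDl (le_trans (ler_distD (y i) _ _))// lerD//.
    exact: (dist_leP _ Qx Qy).1.
  exact: (dist_leP _ Qy Qz).1.
- move=> x /AQ Qx U; split.
    move=> /(nbhs_dist_lt Qx)[e e0 h]; by exists e => // y Ay xy; apply: h => //; exact: AQ.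
  move=> [e e0 h]; have := dist_lt_near Qx e0; apply: filterS => y + Ay.
  by move=> /(_ (AQ _ Ay)); exact: h.
Qed.

Lemma cube_compact : compact cube.
Proof.
have := @tychonoff int (fun=> R) (fun=> `[0, 1]%classic) (fun=> @segment_compact R 0 1).
by congr compact; apply/seteqP; split=> x h i; have := h i; rewrite /= in_itv.
Qed.

End Pointwise.

(** * Density of the monomials in p and q *)

Section Density.
Variables (R : realType) (p q : R).
Hypotheses (p0 : 0 < p) (p1 : p < 1) (q1 : 1 < q).
Hypothesis pq_indep : forall k l : nat, p ^+ k * q ^+ l = 1 -> k = 0%N /\ l = 0%N.

Definition monomials : set R := [set z | exists k l : nat, z = p ^+ k * q ^+ l].

Lemma monomials_gt0 z : monomials z -> 0 < z.
Proof.
by move=> [k [l ->]]; rewrite mulr_gt0// exprn_gt0// (lt_trans ltr01).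
Qed.

Lemma monomialsM z w : monomials z -> monomials w -> monomials (z * w).
Proof.
move=> [k [l ->]] [k' [l' ->]]; exists (k + k')%N, (l + l')%N.
by rewrite !exprD mulrACA.
Qed.

Lemma monomialsX z n : monomials z -> monomials (z ^+ n).
Proof.
move=> mz; elim: n => [|n IH]; first by exists 0%N, 0%N; rewrite mulr1.
by rewrite exprS; exact: monomialsM.
Qed.

Lemma monomials_p : monomials p.
Proof. by exists 1%N, 0%N; rewrite mulr1. Qed.

Lemma monomials_q : monomials q.
Proof. by exists 0%N, 1%N; rewrite mul1r. Qed.

(** Exponents are natural numbers, so they cannot cancel: if the total exponents vanish, so do those
    of each factor. *)
Lemma monomials_mul_eq1 z w : monomials z -> monomials w -> z * w = 1 -> z = 1.
Proof.
move=> [k [l ->]] [k' [l' ->]]; rewrite mulrACA -!exprD => /pq_indep[kk ll].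
have [-> ->] : k = 0%N /\ l = 0%N by lia.
by rewrite mulr1.
Qed.

(* Otherwise the least monomial above 1 and the greatest one below 1 are both
   isolated from 1, and the product of elements close to them lies strictly
   between them, hence equals 1. *)
Lemma monomials_near1 :
  (forall e : R, 0 < e -> exists2 z, monomials z & 1 < z < 1 + e) \/
  (forall e : R, 0 < e -> exists2 z, monomials z & 1 - e < z < 1).
Proof.
pose A := [set z | monomials z /\ 1 < z]; pose B := [set z | monomials z /\ z < 1].
have Aq : A q by split=> //; exact: monomials_q.
have Bp : B p by split=> //; exact: monomials_p.
have infA : has_inf A by split; [exists q|exists 1 => z [_ /ltW]].
have supB : has_sup B by split; [exists p|exists 1 => z [_ /ltW]].
set a := inf A; set b := sup B.
have aP z : monomials z -> 1 < z -> a <= z.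
  by move=> mz z1; apply: ge_inf; [exact: infA.2|split].
have bP z : monomials z -> z < 1 -> z <= b.
  by move=> mz z1; apply: ub_le_sup; [exact: supB.2|split].
have [a1|a1] := leP a 1.
  left=> e e0; have [z [mz z1] za] := inf_adherent e0 infA.
  by exists z => //; rewrite z1 (lt_le_trans za)// lerD2r.
have [b1|b1] := leP 1 b.
  right=> e e0; have [z [mz z1] zb] := sup_adherent e0 supB.
  by exists z => //; rewrite z1 andbT (le_lt_trans _ zb)// lerD2r.
exfalso.
have b0 : 0 < b by apply: lt_le_trans p0 _; exact: bP monomials_p p1.
have a0 : 0 < a by lra.
(* These tolerances give [z < a (2 - b)] and [w > b / a]. Hence [z w >= a w > b] and
   [z w <= z b < a (1 - (1 - b)^2) < a], which leaves only [z w = 1]. *)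
have e1 : 0 < a * (1 - b) by rewrite mulr_gt0// subr_gt0.
have e2 : 0 < b * (a - 1) / a by rewrite divr_gt0// mulr_gt0// subr_gt0.
have [z [mz z1] za] := inf_adherent e1 infA.
have [w [mw w1] wb] := sup_adherent e2 supB.
have z0 := monomials_gt0 mz; have w0 := monomials_gt0 mw.
have mzw := monomialsM mz mw.
have [zw|zw|zw] := ltgtP (z * w) 1.
- have : z * w <= b by exact: bP.
  have : a * w <= z * w by rewrite ler_pM2r// aP.
  have : a * (b - b * (a - 1) / a) < a * w by rewrite ltr_pM2l.
  have -> : a * (b - b * (a - 1) / a) = b by field; rewrite gt_eqF.
  lra.
- have : a <= z * w by exact: aP.
  have : z * w <= z * b by rewrite ler_pM2l// bP.
  have : z * b < (a + a * (1 - b)) * b by rewrite ltr_pM2r.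
  have : 0 < a * ((1 - b) * (1 - b)) by rewrite mulr_gt0// mulr_gt0// subr_gt0.
  nra.
- by move: z1; rewrite (monomials_mul_eq1 mz mw zw) ltxx.
Qed.

Lemma expr_unbounded (z c : R) : 1 < z -> exists n, c < z ^+ n.
Proof.
move=> z1.
have bernoulli n : 1 + n%:R * (z - 1) <= z ^+ n.
  elim: n => [|n IH]; first by rewrite mul0r addr0.
  rewrite exprS -natr1; have n0 : 0 <= n%:R :> R by [].
  have : z * (1 + n%:R * (z - 1)) <= z * z ^+ n by rewrite ler_pM2l// (lt_trans ltr01).
  have : 0 <= n%:R * ((z - 1) * (z - 1)) by rewrite mulr_ge0// mulr_ge0// subr_ge0 ltW.
  nra.
exists (Num.trunc (c / (z - 1))).+1; apply: lt_le_trans (bernoulli _).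
have : c / (z - 1) < (Num.trunc (c / (z - 1))).+1%:R by exact: truncnS_gt.
by rewrite ltr_pdivrMr ?subr_gt0//; lra.
Qed.

Lemma expr_vanishing (z c : R) : 0 < z < 1 -> 0 < c -> exists n, z ^+ n < c.
Proof.
move=> /andP[z0 z1] c0.
have [|n] := @expr_unbounded z^-1 c^-1; first by rewrite invf_gt1.
by exists n; rewrite -ltf_pV2 ?posrE ?exprn_gt0// -exprVn.
Qed.

(** A power of [p] or [q] moves [a] to one side of 1; repeated multiplication by a monomial [z] very
    close to 1 then crosses 1 in steps too short to jump over the interval from [b] to 1. *)
Lemma monomials_reach (a b : R) : 0 < a -> b < 1 ->
  exists k l : nat, b < a * (p ^+ k * q ^+ l) < 1.
Proof.
wlog b0 : b / 0 < b.
  move=> H a0 b1; have [||k [l /andP[h h']]] := H (Num.max b 2^-1) _ a0 _.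
  - by rewrite lt_max invr_gt0 ltr0n orbT.
  - by rewrite gt_max b1 invf_lt1 ?ltr1n.
  by exists k, l; rewrite h' andbT; apply: le_lt_trans h; rewrite le_max lexx.
move=> a0 b1.
suff [w [k [l ->]] h] : exists2 w, monomials w & b < a * w < 1 by exists k, l.
have [near1|near1] := monomials_near1.
  (* Case [1 < z < 1 / b]: start below 1 and stop just before the first power that reaches 1. *)
  have [|z mz /andP[z1 zb]] := near1 (b^-1 - 1); first by rewrite subr_gt0 invf_gt1.
  have {}zb : b * z < 1 by rewrite -ltr_pdivlMl// mulr1; lra.
  have [k pk] : exists k, p ^+ k < a^-1.
    by apply: expr_vanishing; rewrite ?p0 ?invr_gt0.
  have apk : a * p ^+ k < 1 by rewrite -ltr_pdivlMl// mulr1.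
  have apk0 : 0 < a * p ^+ k by rewrite mulr_gt0// exprn_gt0.
  have ex : exists n, 1 <= a * p ^+ k * z ^+ n.
    have [n zn] := expr_unbounded (a * p ^+ k)^-1 z1.
    by exists n; rewrite -ler_pdivrMl// mulr1 ltW.
  case: (ex_minnP ex) => -[|n] hn nmin; first by move: hn; rewrite mulr1 leNgt apk.
  have zn1 : a * p ^+ k * z ^+ n < 1.
    by rewrite ltNge; apply/negP => /nmin; rewrite ltnn.
  exists (p ^+ k * z ^+ n).
    by apply: monomialsM; apply: monomialsX => //; exact: monomials_p.
  rewrite mulrA zn1 andbT; move: hn; rewrite exprSr mulrA.
  set u := _ * z ^+ n; move=> uz.
  rewrite -(ltr_pM2r (monomials_gt0 mz)); exact: lt_le_trans uz.
(* Case [b < z < 1]: start above 1 and stop at the first power that falls below 1; the preceding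
   value is at least 1, so this one is at least [z > b]. *)
have [|z mz /andP[zb z1]] := near1 (1 - b); first by rewrite subr_gt0.
have {}zb : b < z by lra.
have z0 := monomials_gt0 mz.
have [k qk] := expr_unbounded a^-1 q1.
have aqk : 1 < a * q ^+ k by rewrite -ltr_pdivrMl// mulr1.
have aqk0 : 0 < a * q ^+ k by rewrite (lt_trans ltr01).
have ex : exists n, a * q ^+ k * z ^+ n < 1.
  have [n zn] : exists n, z ^+ n < (a * q ^+ k)^-1.
    by apply: expr_vanishing; rewrite ?z0 ?invr_gt0.
  by exists n; rewrite -ltr_pdivlMl// mulr1.
case: (ex_minnP ex) => -[|n] hn nmin; first by move: hn; rewrite mulr1 ltNge ltW.
have zn1 : 1 <= a * q ^+ k * z ^+ n.
  by rewrite leNgt; apply/negP => /nmin; rewrite ltnn.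
exists (q ^+ k * z ^+ n.+1).
  by apply: monomialsM; apply: monomialsX => //; exact: monomials_q.
rewrite mulrA hn andbT exprSr mulrA.
by apply: lt_le_trans zb _; rewrite ler_peMl// ltW.
Qed.

End Density.

(** * Connected subsets of the Mahavier product *)

Lemma int_bi_ind (P : int -> Prop) (i : int) :
  P i -> (forall j, P j <-> P (j + 1)) -> forall j, P j.
Proof.
move=> Pi step j.
have up n : P (i + n%:Z).
  elim: n => [|n IH]; first by rewrite addr0.
  by rewrite -addn1 PoszD addrA; apply: (step _).1.
have down n : P (i - n%:Z).
  elim: n => [|n IH]; first by rewrite subr0.
  by apply: (step _).2; rewrite (_ : _ + 1 = i - n%:Z)//; lia.
have -> : j = i + (j - i) by lia.
case: (j - i) => k; first exact: up.
by rewrite NegzE; exact: down.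
Qed.

(** Used to turn approximate equality of two ratios into equality. *)
Lemma seq_gap (R : realType) (s : seq R) :
  exists2 e : R, 0 < e & {in s &, forall w w', `|w - w'| < e -> w = w'}.
Proof.
suff [e e0 h] : exists2 e : R, 0 < e & forall p, p \in [seq (w, w') | w <- s, w' <- s] ->
    `|p.1 - p.2| < e -> p.1 = p.2.
  by exists e => // w w' sw sw'; apply: (h (w, w')); apply/allpairsP; exists (w, w').
elim: [seq _ | _ <- _, _ <- _] => [|p l [e e0 IH]]; first by exists 1.
have [pp|pp] := eqVneq p.1 p.2.
  by exists e => // q; rewrite inE => /predU1P[->|/IH].
exists (Num.min e `|p.1 - p.2|); first by rewrite lt_min e0 normr_gt0 subr_eq0.
move=> q; rewrite inE => /predU1P[->|ql]; rewrite lt_min => /andP[h h'].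
  by rewrite ltxx in h'.
exact: IH.
Qed.

Lemma near_gt (R : realType) (S : topologicalType) (f : S -> R) (s : S) (c : R) :
  {for s, continuous f} -> c < f s -> \forall z \near s, c < f z.
Proof. by move=> cf cs; exact: (cvgr_gt (f s) cf). Qed.

Lemma continuous_subMl (R : realType) (S : topologicalType) (f g : S -> R) (w : R) :
  continuous f -> continuous g -> continuous (fun s => f s - w * g s).
Proof.
move=> cf cg s; apply: cvgB; first exact: cf.
by apply: cvgM; [exact: cvg_cst|exact: cg].
Qed.

Lemma continuous_Ml_sub_norm (R : realType) (S : topologicalType) (f g : S -> R) (w : R) :
  continuous f -> continuous g -> continuous (fun s => w * f s - `|g s|).
Proof.
move=> cf cg s; apply: cvgB; last by apply: cvg_norm; exact: cg.
by apply: cvgM; [exact: cvg_cst|exact: cf].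
Qed.

Lemma recurrence_continuous (R : realType) (i j : int) (w : R) :
  continuous (fun y : {ptws int -> R} => y i - w * y j).
Proof.
exact: (@continuous_subMl R {ptws int -> R} (fun y => y i) (fun y => y j) w
  (@ptws_coord_continuous R i) (@ptws_coord_continuous R j)).
Qed.

Section Fan.
Variables (R : realType) (M : nat) (Omega : M.-tuple R).
Hypothesis Omega_gt0 : forall w, w \in Omega -> 0 < w.
Local Notation T := {ptws int -> R}.
Local Notation X := (mahavier_product (@unit_interval R) (F_of Omega)).
Implicit Types (x y z : T) (C D : set T) (a b : R).

(** * Scaling and positivity *)

Lemma mahavierP x : X x <->
  cube x /\ forall i, exists2 w, w \in Omega & x (i + 1) = w * x i.
Proof.
split=> [[Qx Fx]|[Qx Fx]]; split=> i.
- by have := Qx i; rewrite /unit_interval/= in_itv.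
- by have [] := Fx i.
- by have := Qx i; rewrite /unit_interval/= in_itv.
- by split; rewrite /unit_interval/= ?in_itv//; exact: Qx.
Qed.

Lemma mahavier_cube : X `<=` @cube R.
Proof. by move=> x /mahavierP[]. Qed.

Definition scale a x : T := fun i => a * x i.

Lemma scale1 x : scale 1 x = x.
Proof. by apply/funext => i; rewrite /scale mul1r. Qed.

Lemma scale_scale a b x : scale a (scale b x) = scale (a * b) x.
Proof. by apply/funext => i; rewrite /scale mulrA. Qed.

Lemma scale_continuous x : continuous (fun a : R => scale a x).
Proof. by apply: continuous_ptws => i a; apply: cvgMl; exact: cvg_id. Qed.

(** Factors above 1 are allowed, which covers arcs leading outward along a ray. *)
Lemma mahavier_scale_le1 a x : X x -> 0 <= a -> (forall i, a * x i <= 1) ->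
  X (scale a x).
Proof.
move=> /mahavierP[Qx Fx] a0 ax; apply/mahavierP; split=> i.
  by rewrite /scale ax mulr_ge0//; have /andP[] := Qx i.
by have [w Ow e] := Fx i; exists w => //; rewrite /scale e mulrCA.
Qed.

Lemma mahavier_scale a x : X x -> 0 <= a <= 1 -> X (scale a x).
Proof.
move=> Xx /andP[a0 a1]; apply: mahavier_scale_le1 => // i.
by have /andP[? ?] := mahavier_cube Xx i; rewrite mulr_ile1.
Qed.

(** All ratios are positive, so positivity propagates from one coordinate in both directions. *)
Lemma mahavier_gt0 x i j : X x -> 0 < x i -> 0 < x j.
Proof.
move=> /mahavierP[Qx Fx] xi; move: j; apply: (int_bi_ind xi) => j.
by have [w /Omega_gt0 w0 ->] := Fx j; rewrite pmulr_rgt0.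
Qed.

Lemma mahavier_ge0 x i : X x -> 0 <= x i.
Proof. by move=> /mahavier_cube /(_ i)/andP[]. Qed.

Definition origin : T := fun=> 0.

Lemma scale0 x : scale 0 x = origin.
Proof. by apply/funext => i; rewrite /scale mul0r. Qed.

Lemma scale_origin a : scale a origin = origin.
Proof. by apply/funext => i; rewrite /scale mulr0. Qed.

Lemma mahavier_neq0 x i : X x -> x <> origin -> 0 < x i.
Proof.
move=> Xx x0; rewrite lt_neqAle mahavier_ge0// andbT; apply/eqP => xi.
apply: x0; apply/funext => j; apply/eqP; rewrite eq_le mahavier_ge0// andbT leNgt.
by apply/negP => /(mahavier_gt0 i Xx); rewrite -xi ltxx.
Qed.

Lemma scale_inj a b x : X x -> x <> origin -> scale a x = scale b x -> a = b.
Proof.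
move=> Xx /(mahavier_neq0 0 Xx) x0 /(congr1 (@^~ 0)) /(mulIf _); apply.
by rewrite gt_eqF.
Qed.

(** * Closed connected sets along rays *)

Lemma proportional_window (x y : T) (w : int -> R) (a : R) (n : nat) :
  (forall i, 0 < w i) -> (forall i, x (i + 1) = w i * x i) ->
  (forall i : int, (`|i| < n.+1)%N -> y (i + 1) = w i * y i) ->
  y 0 = a * x 0 -> forall i : int, (`|i| < n.+1)%N -> y i = a * x i.
Proof.
move=> w0 xw yw y0.
have up k : (k <= n)%N -> y k%:Z = a * x k%:Z.
  elim: k => // k IH kn; rewrite -addn1 PoszD yw ?xw ?IH//; try exact: ltnW.
  by rewrite mulrCA.
(* The value at [-(k + 1)] comes from the recurrence at that same index, so the window of ratios
   must include [-n]. *)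
have down k : (k <= n)%N -> y (- k%:Z) = a * x (- k%:Z).
  elim: k => // k IH kn; apply: (mulfI (lt0r_neq0 (w0 (- k.+1%:Z)))).
  have k1 : - k.+1%:Z + 1 = - k%:Z by lia.
  have yk : y (- k%:Z) = w (- k.+1%:Z) * y (- k.+1%:Z).
    by rewrite -k1 yw// abszN.
  have xk : x (- k%:Z) = w (- k.+1%:Z) * x (- k.+1%:Z) by rewrite -k1 xw.
  by rewrite -yk mulrCA -xk IH// ltnW.
by move=> [k|k] kn; [exact: up|rewrite NegzE; exact: down].
Qed.


(* The points of the connected set agreeing with the direction of x on a large
   window and having 0-th coordinate above that of a x form a relatively clopen
   set: ratios of consecutive coordinates are discrete, and the boundary case
   would be a point close to a x. *)
Lemma closed_connected_ray C x a : C `<=` X -> closed C -> connected C -> C x ->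
  0 <= a < 1 -> ~ C (scale a x) ->
  forall y, C y -> exists2 b, a < b & y = scale b x.
Proof.
move=> CX clC cC Cx /andP[a0 a1] Cax.
have Xx := CX _ Cx.
have x_neq0 : x <> origin by move=> x0; apply: Cax; rewrite x0 scale_origin -x0.
have x_gt0 i : 0 < x i by exact: mahavier_neq0.
have [Qx Fx] := (mahavierP x).1 Xx.
pose w i := x (i + 1) / x i.
have xw i : x (i + 1) = w i * x i by rewrite divfK// gt_eqF.
have w_gt0 i : 0 < w i by rewrite divr_gt0.
have Ow i : w i \in Omega by have [v Ov e] := Fx i; rewrite /w e mulfK// gt_eqF.
have [eps eps0 gap] := seq_gap Omega.
have Xax : X (scale a x) by apply: mahavier_scale => //; rewrite a0 ltW.
have [e e0 far] : exists2 e : R, 0 < e & forall y, cube y -> dist (scale a x) y < e -> ~ C y.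
  apply: nbhs_dist_lt; first exact: mahavier_cube.
  by apply: open_nbhs_nbhs; split => //; exact: closed_openC.
have [n nP] := dist_lt_window e0.
(* Both sets ask for the ratios of [x] on a window: [U m] up to [eps], an open condition, and [K m]
   exactly, a closed one. Multiplying by [y i] avoids division. *)
pose U m := [set y : T | a * x 0 < y 0 /\
  forall i : int, (`|i| < m)%N -> 0 < eps * y i - `|y (i + 1) - w i * y i|].
pose K m := [set y : T | a * x 0 <= y 0] `&`
  \bigcap_(i in [set i : int | (`|i| < m)%N]) [set y : T | y (i + 1) - w i * y i = 0].
have oU m : open (U m).
  rewrite openE => y [y0 yU].
  have near0 : \forall z \near y, a * x 0 < z 0.
    exact: (@near_gt R T (fun z => z 0) y _ (@ptws_coord_continuous R 0 y) y0).
  (* The bound on [i] is repeated inside the predicate because [near_forall_int] wants an eventual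
     statement for every [i]. *)
  have near_i : \forall z \near y, forall i : int, (`|i| < m)%N ->
      (`|i| < m)%N -> 0 < eps * z i - `|z (i + 1) - w i * z i|.
    apply: (@near_forall_int _ (nbhs y)
      (fun i z => (`|i| < m)%N -> 0 < eps * z i - `|z (i + 1) - w i * z i|) m) => i.
    have [im|im] := boolP (`|i| < m)%N; last by apply: nearW.
    have : \forall z \near y, 0 < eps * z i - `|z (i + 1) - w i * z i|.
      apply: (@near_gt R T (fun z => eps * z i - `|z (i + 1) - w i * z i|) y 0);
        last exact: yU.
      exact: (@continuous_Ml_sub_norm R {ptws int -> R} (fun z => z i)
        (fun z => z (i + 1) - w i * z i) eps (@ptws_coord_continuous R i)
        (@recurrence_continuous R (i + 1) i (w i)) y).
    by apply: filterS.
  near=> z; split; first by near: z.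
  have zU : forall i : int, (`|i| < m)%N -> (`|i| < m)%N ->
    0 < eps * z i - `|z (i + 1) - w i * z i| by near: z.
  by move=> i im; exact: zU.
have clK m : closed (K m).
  apply: closedI.
    apply: (@preimage_closed _ _ (fun y : T => y 0) [set r | a * x 0 <= r]).
      by move=> y _; exact: ptws_coord_continuous.
    exact: closed_ge.
  apply: closed_bigI => i _.
  apply: (@preimage_closed _ _ (fun y : T => y (i + 1) - w i * y i) [set 0]).
    by move=> y _; exact: recurrence_continuous.
  exact: closed_eq.
have CU m : (n < m)%N -> C `&` U m = C `&` K m.
  move=> nm; apply/seteqP; split=> y [Cy].
    move=> [y0 yU]; split=> //; split; first exact: ltW.
    move=> i im.
    have [_ /(_ i) [v Ov yv]] := (mahavierP y).1 (CX _ Cy).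
    have yi : 0 < y i.
      by apply: (mahavier_gt0 i (CX _ Cy)); apply: le_lt_trans y0; rewrite mulr_ge0// ltW.
    (* Two letters of [Omega] closer than [eps] coincide, so on [C] the open condition implies the
       exact one. *)
    have := yU i im; rewrite yv -mulrBl normrM (gtr0_norm yi) -mulrBl pmulr_lgt0// subr_gt0.
    by move=> /(gap _ _ Ov (Ow i)) vw; rewrite /= yv vw subrr.
  move=> [/= y0 yK].
  have yw i : (`|i| < m)%N -> y (i + 1) = w i * y i.
    by move=> im; apply/eqP; rewrite -subr_eq0; apply/eqP; exact: yK.
  have {}y0 : a * x 0 < y 0.
    (* With [y 0 = a * x 0], the point [y] would agree with [a x] on the window of size [n], hence
       lie within [e] of it and outside [C]. *)
    rewrite lt_neqAle y0 andbT; apply/eqP => y0e; apply: (far y) => //.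
      exact/mahavier_cube/CX.
    apply: nP => [||i iN]; [exact: mahavier_cube|exact/mahavier_cube/CX|].
    rewrite (@proportional_window x y w a n)//; last exact: ltnW.
      by rewrite /scale subrr normr0 divr_ge0// ltW.
    by move=> j jn; apply: yw; exact: leq_trans nm.
  split=> //; split=> // i im; rewrite yw// subrr normr0 subr0 mulr_gt0//.
  by apply: (mahavier_gt0 i (CX _ Cy)); apply: le_lt_trans y0; rewrite mulr_ge0// ltW.
have CeqU m : (n < m)%N -> C `&` U m = C.
  move=> nm; apply: cC; last 2 first.
  - by exists (U m).
  - by exists (K m) => //; exact: CU.
  exists x; split=> //; split; first by rewrite gtr_pMl.
  by move=> i _; rewrite xw subrr normr0 subr0 mulr_gt0.
move=> y Cy.
have yK m : (n < m)%N -> K m y by move=> nm; move: Cy; rewrite -(CeqU _ nm) CU// => -[].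
have : U n.+1 y by move: Cy; rewrite -(CeqU n.+1)// => -[].
move=> [y0 _]; exists (y 0 / x 0); first by rewrite ltr_pdivlMr.
(* The factor [y 0 / x 0] does not depend on the window, which can therefore be enlarged to reach
   any [i]. *)
apply/funext => i.
have := @proportional_window x y w (y 0 / x 0) (n + `|i|)%N; apply => //.
- move=> j jn; apply/eqP; rewrite -subr_eq0; apply/eqP.
  by have [_ ] := yK (n + `|i|).+1 (leq_addr _ _); exact.
- by rewrite divfK// gt_eqF.
- by rewrite ltnS leq_addl.
Unshelve. all: by end_near.
Qed.

(** A missing point of the segment from the origin to [x] would confine [C] to the ray of [x], which
    does not contain [y]. *)
Lemma mem_ray_incomparable C x y a : C `<=` X -> closed C -> connected C ->
  C x -> C y -> (forall b, 0 <= b -> y <> scale b x) -> 0 <= a <= 1 -> C (scale a x).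
Proof.
move=> CX clC cC Cx Cy xy /andP[a0]; rewrite le_eqVlt => /predU1P[->|a1].
  by rewrite scale1.
apply: contrapT => Cax.
have [|b ab yb] := closed_connected_ray CX clC cC Cx _ Cax Cy; first by rewrite a0.
by apply: (xy b); rewrite // ltW// (le_lt_trans a0).
Qed.

(** If [a x] were missing, all of [C] would lie strictly above it on the ray, but [b x] does not. *)
Lemma mem_ray_between C x a b : C `<=` X -> closed C -> connected C ->
  C x -> C (scale b x) -> 0 <= b -> b <= a <= 1 -> C (scale a x).
Proof.
move=> CX clC cC Cx Cbx b0 /andP[ba]; rewrite le_eqVlt => /predU1P[->|a1].
  by rewrite scale1.
have [x0|x0] := pselect (x = origin); first by rewrite x0 scale_origin -x0.
apply: contrapT => Cax.
have [|c ac bc] := closed_connected_ray CX clC cC Cx _ Cax Cbx.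
  by rewrite a1 (le_trans b0).
by move: ac; rewrite -(scale_inj (CX _ Cx) x0 bc) ltNge ba.
Qed.

Definition segment x b : set T := (fun a => scale a x) @` `[b, 1]%classic.

Lemma segment_connected x b : connected (segment x b).
Proof.
apply: connected_continuous_connected; first exact: normed_module.segment_connected.
by apply: continuous_subspaceT; exact: scale_continuous.
Qed.

Lemma segment_mem x b : b <= 1 -> segment x b x.
Proof. by move=> b1; exists 1; [rewrite /= in_itv/= b1 lexx|exact: scale1]. Qed.

Lemma segment_sub C x b : C `<=` X -> closed C -> connected C ->
  C x -> C (scale b x) -> 0 <= b -> segment x b `<=` C.
Proof.
move=> CX clC cC Cx Cbx b0 _ [a + <-]; rewrite /= in_itv => ab.
exact: mem_ray_between ab.
Qed.

Lemma segment_sub_incomparable C x y : C `<=` X -> closed C -> connected C ->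
  C x -> C y -> (forall b, 0 <= b -> y <> scale b x) -> segment x 0 `<=` C.
Proof.
move=> CX clC cC Cx Cy xy _ [a + <-]; rewrite /= in_itv => ab.
exact: mem_ray_incomparable xy ab.
Qed.

Lemma comparable_sym x y b : X x -> y <> origin -> 0 <= b -> y = scale b x ->
  0 < b /\ x = scale b^-1 y.
Proof.
move=> Xx y0; rewrite le_eqVlt => /predU1P[<-|b0 ->]; first by rewrite scale0.
by split=> //; rewrite scale_scale mulVf ?scale1// gt_eqF.
Qed.

(** Any two points are joined by one or two segments that every closed connected subset of the
    product containing both points must contain; these segments therefore lie in the
    intersection. *)
Lemma connected_setI C D : C `<=` X -> D `<=` X -> closed C -> closed D ->
  connected C -> connected D -> connected (C `&` D).
Proof.
move=> CX DX clC clD cC cD.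
suff joined x y : (C `&` D) x -> (C `&` D) y ->
    exists S, [/\ connected S, S `<=` C `&` D, S x & S y].
  have [->|/set0P[x CDx]] := eqVneq (C `&` D) set0; first exact: connected0.
  have {}joined y : exists S, (C `&` D) y -> [/\ connected S, S `<=` C `&` D, S x & S y].
    have [/(joined _ _ CDx)[S HS]|n] := pselect ((C `&` D) y); first by exists S.
    by exists set0 => /n.
  have [S HS] := choice joined.
  have -> : C `&` D = \bigcup_(y in C `&` D) S y.
    apply/seteqP; split=> [y CDy|y [z /HS[_ SCD _ _] /SCD//]].
    by exists y => //; have [] := HS y CDy.
  by apply: bigcup_connected => [|y /HS[]//]; exists x => y /HS[].
move=> [Cx Dx] [Cy Dy].
have [y0|y0] := pselect (y = origin).
  exists (segment x 0); split.
  - exact: segment_connected.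
  - by move=> z xz; split; [apply: (segment_sub CX) xz|apply: (segment_sub DX) xz];
      rewrite // scale0 -y0.
  - exact: segment_mem.
  - by exists 0; rewrite ?scale0//= in_itv/= lexx ler01.
have [x0|x0] := pselect (x = origin).
  exists (segment y 0); split.
  - exact: segment_connected.
  - by move=> z yz; split; [apply: (segment_sub CX) yz|apply: (segment_sub DX) yz];
      rewrite // scale0 -x0.
  - by exists 0; rewrite ?scale0//= in_itv/= lexx ler01.
  - exact: segment_mem.
have [[b [b0 yb]]|xy] := pselect (exists b, 0 <= b /\ y = scale b x).
  have [{}b0 xb] := comparable_sym (CX _ Cx) y0 b0 yb.
  have [b1|b1] := leP b 1.
    exists (segment x b); split.
    - exact: segment_connected.
    - move=> z xz; split; [apply: (segment_sub CX) xz|apply: (segment_sub DX) xz];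
        by rewrite -?yb// ltW.
    - exact: segment_mem.
    - by exists b; rewrite //= in_itv/= lexx.
  have bV1 : b^-1 <= 1 by rewrite invf_le1// ltW.
  exists (segment y b^-1); split.
  - exact: segment_connected.
  - move=> z xz; split; [apply: (segment_sub CX) xz|apply: (segment_sub DX) xz];
      by rewrite -?xb// invr_ge0 ltW.
  - by exists b^-1; rewrite //= in_itv/= lexx.
  - exact: segment_mem.
have {}xy b : 0 <= b -> y <> scale b x by move=> b0 yb; apply: xy; exists b.
have yx b : 0 <= b -> x <> scale b y.
  move=> b0 xb.
  have [b1 yb] := comparable_sym (CX _ Cy) x0 b0 xb.
  by apply: (xy b^-1) => //; rewrite invr_ge0.
(* For different directions both sets contain the two full segments down to the origin. *)
exists (segment x 0 `|` segment y 0); split.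
- apply: connectedU; [|exact: segment_connected..].
  exists origin; split; exists 0; rewrite ?scale0//= in_itv/= lexx; exact: ler01.
- move=> z [xz|yz]; split.
  + exact: (segment_sub_incomparable CX clC cC Cx Cy) xz.
  + exact: (segment_sub_incomparable DX clD cD Dx Dy) xz.
  + exact: (segment_sub_incomparable CX clC cC Cy Cx) yz.
  + exact: (segment_sub_incomparable DX clD cD Dy Dx) yz.
- by left; exact: segment_mem.
- by right; exact: segment_mem.
Qed.

(* The set C contains a germ at x of the ray of x, on the side of larger
   multiples when s = false and of smaller ones when s = true. *)
Definition side x (s : bool) C : Prop :=
  exists2 d : R, 0 < d & forall t, 0 <= t <= d -> C (scale (1 + (-1) ^+ s * t) x).

Lemma side_meet x s C D : X x -> x <> origin -> side x s C -> side x s D ->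
  exists2 y, y <> x & (C `&` D) y.
Proof.
move=> Xx x0 [d d0 dC] [d' d'0 dD]; pose t := Num.min d d'.
have t0 : 0 < t by rewrite lt_min d0.
exists (scale (1 + (-1) ^+ s * t) x); last first.
  by split; [apply: dC|apply: dD]; rewrite ge_min lexx ?orbT ltW.
rewrite -[X in _ <> X]scale1 => /(scale_inj Xx x0)/eqP.
by rewrite -subr_eq0 addrAC subrr add0r mulf_eq0 signr_eq0 gt_eqF.
Qed.

(** The position of [z] decides the side: the larger one if [z] lies beyond [x] on its ray, the
    smaller one if [z] lies below [x] or in another direction. *)
Lemma side_exists C x z : C `<=` X -> closed C -> connected C ->
  C x -> C z -> z <> x -> x <> origin -> exists s, side x s C.
Proof.
move=> CX clC cC Cx Cz zx x0.
have [[b [b0 zb]]|xz] := pselect (exists b, 0 <= b /\ z = scale b x); last first.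
  exists true, 1 => // t t01; apply: (mem_ray_incomparable CX clC cC Cx Cz).
    by move=> b b0 zb; apply: xz; exists b.
  by rewrite expr1; lra.
have [b1|b1|b1] := ltgtP b 1; last by rewrite zb b1 scale1 in zx.
  exists true, (1 - b) => [|t t01]; first by rewrite subr_gt0.
  apply: (mem_ray_between CX clC cC Cx (b := b)); rewrite -?zb//.
  by rewrite expr1; lra.
exists false, (b - 1) => [|t t01]; first by rewrite subr_gt0.
have {}b0 : 0 < b by lra.
(* Now [z] is the outer point, so the germ is rewritten in multiples of [z]. *)
have xb : x = scale b^-1 z by rewrite zb scale_scale mulVf ?scale1// gt_eqF.
rewrite {1}xb scale_scale expr0 mul1r.
apply: (mem_ray_between CX clC cC Cz (b := b^-1)); rewrite -?xb ?invr_ge0 ?(ltW b0)//.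
by rewrite ler_pMl ?invr_gt0// ler_pdivrMr// mul1r; lra.
Qed.

Lemma homeomorphism_image_closed_connected (S : topologicalType) (K K' : set S)
    (B : set T) (f : S -> T) :
  homeomorphism K B f -> B `<=` X -> K' `<=` K -> compact K' -> connected K' ->
  [/\ f @` K' `<=` X, closed (f @` K') & connected (f @` K')].
Proof.
move=> [fKB cf _] BX KK cK' connK'.
have cf' := continuous_subspaceW KK cf.
split; first by move=> _ [s K's <-]; apply: BX; apply: fKB; exact: KK.
  by apply: compact_closed; [exact: hausdorff_ptws|exact: continuous_compact].
exact: connected_continuous_connected.
Qed.

(** * Tips of rays are endpoints *)

(** Expresses that the coordinates have supremum 1, so that [x] cannot be prolonged along its
    ray. *)
Definition tip x := X x /\ forall m : R, m < 1 -> exists i, m < x i.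

Lemma tip_neq_origin x : tip x -> x <> origin.
Proof. by move=> [_ /(_ 0 ltr01)[i + x0]]; rewrite x0 ltxx. Qed.

Lemma tip_side x C : tip x -> C `<=` X -> ~ side x false C.
Proof.
move=> [Xx xtip] CX [d d0 /(_ d)]; rewrite lexx ltW// expr0 mul1r => /(_ isT) /CX Xd.
have d10 : 0 < 1 + d by lra.
have [|i xi] := xtip (1 + d)^-1; first by rewrite invf_lt1//; lra.
have /andP[_] := mahavier_cube Xd i.
by rewrite /scale -ler_pdivlMl// mulr1 leNgt xi.
Qed.

(** If [x] were interior to an arc, both subarcs issuing from [x] would leave it on the side of
    smaller multiples and meet again away from [x], against injectivity. *)
Lemma tip_endpoint x : tip x -> endpoints R X x.
Proof.
move=> tx; have [Xx _] := tx; split=> // B BX [f Hf] Bx.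
have x0 := tip_neq_origin tx.
have [t t01 ftx] := homeomorphism_surj Hf Bx.
have I0 : unit_interval (0 : R) by rewrite /unit_interval/= in_itv/= lexx ler01.
have I1 : unit_interval (1 : R) by rewrite /unit_interval/= in_itv/= lexx ler01.
have [t0|t0] := eqVneq t 0; first by exists (f 1), f; rewrite -t0.
have [t1|t1] := eqVneq t 1.
  by exists (f 0); apply: arc_from_to_sym; exists f; rewrite -t1.
have {t0 t1} [t0 t1] : 0 < t /\ t < 1.
  move: t01; rewrite /unit_interval/= in_itv/= => /andP[].
  by rewrite !le_eqVlt eq_sym (negbTE t0) (negbTE t1).
have sub0 : `[0, t]%classic `<=` @unit_interval R.
  by move=> r; rewrite /unit_interval/= !in_itv/=; lra.
have sub1 : `[t, 1]%classic `<=` @unit_interval R.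
  by move=> r; rewrite /unit_interval/= !in_itv/=; lra.
have [CX clC cC] := homeomorphism_image_closed_connected Hf BX sub0
  (@segment_compact _ _ _) (@normed_module.segment_connected _ _ _).
have [DX clD cD] := homeomorphism_image_closed_connected Hf BX sub1
  (@segment_compact _ _ _) (@normed_module.segment_connected _ _ _).
have [|||s sC] := side_exists (z := f 0) CX clC cC _ _ _ x0.
- by exists t => //=; rewrite in_itv/=; lra.
- by exists 0 => //=; rewrite in_itv/=; lra.
- by rewrite -ftx => /(homeomorphism_inj Hf I0 t01) t0'; rewrite -t0' ltxx in t0.
have [|||s' sD] := side_exists (z := f 1) DX clD cD _ _ _ x0.
- by exists t => //=; rewrite in_itv/=; lra.
- by exists 1 => //=; rewrite in_itv/=; lra.
- by rewrite -ftx => /(homeomorphism_inj Hf I1 t01) t1'; rewrite -t1' ltxx in t1.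
case: s sC => sC; last by case: (tip_side tx CX sC).
case: s' sD => sD; last by case: (tip_side tx DX sD).
have [y yx [[r /= r0t fry] [r' /= r't1 fr'y]]] := side_meet Xx x0 sC sD.
exfalso; apply: yx; rewrite -fry -ftx; congr f.
have rr' : r = r'.
  by apply: (homeomorphism_inj Hf); [exact: sub0|exact: sub1|rewrite fry].
move: r0t r't1; rewrite -rr' !in_itv/= => /andP[_ rt] /andP[tr _].
by apply/eqP; rewrite eq_le rt tr.
Qed.

(** * Arcs from the origin and smoothness *)

Lemma unit_intervalP (r : R) : unit_interval r <-> 0 <= r <= 1.
Proof. by rewrite /unit_interval/= in_itv. Qed.

Lemma compact_unit_interval : compact (@unit_interval R).
Proof. exact: segment_compact. Qed.

(** The arc contains the segment because it is closed, connected and contains both ends. A point [z]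
    off the segment would cut the arc into two pieces, one of which would contain the far end of the
    other. *)
Lemma arc_from_origin B x : B `<=` X -> arc_from_to R B origin x -> B = segment x 0.
Proof.
move=> BX [f [Hf f0 f1]].
have I0 : unit_interval (0 : R) by apply/unit_intervalP; rewrite lexx ler01.
have I1 : unit_interval (1 : R) by apply/unit_intervalP; rewrite lexx ler01.
have x0 : x <> origin.
  by rewrite -f0 -f1 => /(homeomorphism_inj Hf I1 I0) /eqP; rewrite oner_eq0.
apply/seteqP; split; last first.
  have [_ clB cB] := homeomorphism_image_closed_connected Hf BX
    (@subset_refl _ _) compact_unit_interval (@normed_module.segment_connected _ _ _).
  rewrite -(homeomorphism_image Hf) in clB cB BX *; apply: segment_sub => //.
    by exists 1.
  by rewrite scale0; exists 0.
move=> z Bz; apply: contrapT => zx.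
have [t t01 ftz] := homeomorphism_surj Hf Bz.
have sub0 : `[0, t]%classic `<=` @unit_interval R.
  by move/unit_intervalP: t01 => t01 r; rewrite /unit_interval/= !in_itv/=; lra.
have sub1 : `[t, 1]%classic `<=` @unit_interval R.
  by move/unit_intervalP: t01 => t01 r; rewrite /unit_interval/= !in_itv/=; lra.
have [CX clC cC] := homeomorphism_image_closed_connected Hf BX sub0
  (@segment_compact _ _ _) (@normed_module.segment_connected _ _ _).
have [DX clD cD] := homeomorphism_image_closed_connected Hf BX sub1
  (@segment_compact _ _ _) (@normed_module.segment_connected _ _ _).
have /andP[t0 t1] := (unit_intervalP _).1 t01.
have Cz : (f @` `[0, t]%classic) z by exists t => //=; rewrite in_itv/= lexx t0.
have Dz : (f @` `[t, 1]%classic) z by exists t => //=; rewrite in_itv/= lexx t1.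
have Dx : (f @` `[t, 1]%classic) x by exists 1 => //=; rewrite in_itv/= lexx t1.
have C0 : (f @` `[0, t]%classic) origin by exists 0 => //=; rewrite in_itv/= lexx t0.
have z0 : z <> origin.
  by move=> z0; apply: zx; exists 0; rewrite /= ?in_itv/= ?lexx ?ler01// scale0.
(* If [z] lies beyond [x], the piece from the origin to [z] already passes through [x]. *)
have [[b [b0 zb]]|xz] := pselect (exists b, 0 <= b /\ z = scale b x).
  have [{}b0 xb] := comparable_sym (DX _ Dx) z0 b0 zb.
  have b1 : 1 < b.
    rewrite ltNge; apply/negP => b1; apply: zx.
    by exists b; rewrite //= in_itv/= b1 ltW.
  have [r] : (f @` `[0, t]%classic) x.
    apply: (segment_sub CX clC cC Cz _ (lexx 0)); first by rewrite scale0.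
    by exists b^-1; rewrite //= in_itv/= invr_ge0 ltW//= invf_le1// ltW.
  move=> rt; rewrite -f1 => /(homeomorphism_inj Hf (sub0 _ rt) I1) r1.
  move: rt; rewrite r1 /= in_itv/= ler01/= => t1'.
  have t1e : t = 1 by apply/eqP; rewrite eq_le t1.
  by apply: zx; rewrite -ftz t1e f1; exact: segment_mem.
(* If [z] has another direction, the piece from [z] to [x] passes through the origin. *)
have [r rt] : (f @` `[t, 1]%classic) origin.
  rewrite -(scale0 x); apply: (mem_ray_incomparable DX clD cD Dx Dz).
    by move=> b b0 zb; apply: xz; exists b.
  by rewrite lexx ler01.
rewrite -f0 => /(homeomorphism_inj Hf (sub1 _ rt) I0) r0.
move: rt; rewrite r0 /= in_itv/= ler01 andbT => t0'.
have t0e : t = 0 by apply/eqP; rewrite eq_le t0 t0'.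
by apply: z0; rewrite -ftz t0e f0.
Qed.

Lemma arc_in_origin B x : arc_in R X origin x B -> B = segment x 0.
Proof.
move=> [BX [[<- ->]|[_ /(arc_from_origin BX)//]]].
(* The segment of the origin degenerates to a point, matching the convention for the trivial arc. *)
apply/seteqP; split=> [_ ->|_ [a _ <-]]; first by exact: segment_mem.
exact: scale_origin.
Qed.

Lemma dist_scale a x y : X x -> X y -> 0 <= a <= 1 ->
  dist (scale a x) (scale a y) <= dist x y.
Proof.
move=> Xx Xy a01; have [Qx Qy] := (mahavier_cube Xx, mahavier_cube Xy).
apply/dist_leP => [||i]; try exact/mahavier_cube/mahavier_scale.
have /andP[a0 a1] := a01.
rewrite /scale -mulrBr normrM (ger0_norm a0).
apply: (@le_trans _ _ `|x i - y i|); first by rewrite ler_piMl.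
exact: (dist_leP _ Qx Qy).1.
Qed.

(** Points with the same scaling factor are paired; a factor in the unit interval does not increase
    [dist]. *)
Lemma hausdorff_distance_segment x y e : X x -> X y -> dist x y < e ->
  0 <= hausdorff_distance (@dist R) (segment x 0) (segment y 0) <= e.
Proof.
move=> Xx Xy xye; rewrite /hausdorff_distance; set E := [set _ | _].
have E0 : lbound E 0 by move=> r [/ltW].
have Ee : E e.
  split.
  - by apply: le_lt_trans xye; exact: dist_ge0 (mahavier_cube Xx) (mahavier_cube Xy).
  - move=> _ [a + <-]; rewrite /= in_itv => a01; exists (scale a y); first by exists a.
    by apply: le_lt_trans xye; exact: dist_scale.
  - move=> _ [a + <-]; rewrite /= in_itv => a01; exists (scale a x); first by exists a.
    by apply: le_lt_trans xye; exact: dist_scale.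
rewrite lb_le_inf//=; last by exists e.
by apply: ge_inf => //; exists 0.
Qed.

Lemma mahavier_smooth : smooth (@dist R) X origin.
Proof.
move=> x_ x Xx_ Xx x_x B_ B HB_ /arc_in_origin ->.
apply/cvgrPdist_le => e e0.
have /x_x := dist_lt_near (mahavier_cube Xx) e0; rewrite nbhs_simpl => xn.
near=> n.
rewrite (arc_in_origin (HB_ n)) sub0r normrN.
have /andP[h0 he] : 0 <= hausdorff_distance (@dist R) (segment (x_ n) 0) (segment x 0) <= e.
  apply: hausdorff_distance_segment => //.
  have [_ _ -> // _ _] := compatible_metric_dist mahavier_cube.
  by have := mahavier_cube (Xx_ n); near: n.
by rewrite ger0_norm.
Unshelve. all: by end_near.
Qed.

(** * The product as a hereditarily unicoherent continuum *)

(** Since [Omega] is finite, the condition on each pair of consecutive coordinates is a finite union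
    of closed conditions. *)
Lemma mahavier_closed : closed X.
Proof.
rewrite (_ : (X : set T) = @cube R `&` \bigcap_(i in [set: int])
    \bigcup_(w in [set` Omega]) [set x : T | x (i + 1) - w * x i = 0]).
  apply: closedI; first by apply: compact_closed; [exact: hausdorff_ptws|exact: cube_compact].
  apply: closed_bigI => i _; apply: closed_bigcup => [|w _]; first exact: finite_seq.
  apply: (@preimage_closed _ _ (fun x : T => x (i + 1) - w * x i) [set 0]).
    by move=> y _; exact: recurrence_continuous.
  exact: closed_eq.
apply/seteqP; split=> x.
  move=> /mahavierP[Qx Fx]; split=> // i _.
  by have [w Ow e] := Fx i; exists w => //=; rewrite e subrr.
move=> [Qx Fx]; apply/mahavierP; split=> // i.
by have [w Ow /= /eqP] := Fx i I; rewrite subr_eq0 => /eqP; exists w.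
Qed.

Lemma mahavier_compact : compact X.
Proof.
by apply: subclosed_compact mahavier_closed (@cube_compact R) _; exact: mahavier_cube.
Qed.

Lemma mahavier_connected : connected X.
Proof.
rewrite (_ : (X : set T) = \bigcup_(x in X) segment x 0).
  apply: bigcup_connected => [|x _]; last exact: segment_connected.
  by exists origin => x _; exists 0; rewrite ?scale0//= in_itv/= lexx ler01.
apply/seteqP; split=> [x Xx|_ [x Xx [a + <-]]]; first by exists x => //; exact: segment_mem.
by rewrite /= in_itv => a01; exact: mahavier_scale.
Qed.

Lemma mahavier_hereditarily_unicoherent : hereditarily_unicoherent (@dist R) X.
Proof.
move=> A AX _ B C [_ _ cB connB] [_ _ cC connC] ABC.
have BX : B `<=` X by move=> x Bx; apply: AX; rewrite ABC; left.
have CX : C `<=` X by move=> x Cx; apply: AX; rewrite ABC; right.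
by apply: connected_setI => //; apply: compact_closed => //; exact: hausdorff_ptws.
Qed.

(** * Arcwise connectedness *)

Lemma arc_along_ray x b : X x -> X (scale b x) -> 0 <= b -> b <> 1 -> x <> origin ->
  exists2 B, B `<=` X & arc_from_to R B x (scale b x).
Proof.
move=> Xx Xbx b0 b1 x0; pose f t : T := scale (1 - t + t * b) x.
exists (f @` @unit_interval R); last exists f; first last.
  split; last 2 first.
  - by rewrite /f subr0 mul0r addr0 scale1.
  - by rewrite /f subrr add0r mul1r.
  apply: compact_inj_homeomorphism; [exact: 0|exact: hausdorff_ptws|
    exact: compact_unit_interval| |].
    apply: continuous_subspaceT => t.
    apply: (@continuous_comp R R T (fun t => 1 - t + t * b) (fun a => scale a x));
      last exact: scale_continuous.
    apply: cvgD; first by apply: cvgB; [exact: cvg_cst|exact: cvg_id].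
    by apply: cvgMl; exact: cvg_id.
  move=> s t _ _ /(scale_inj Xx x0) st.
  have : (b - 1) * (s - t) = 0 by lra.
  by move=> /eqP; rewrite mulf_eq0 !subr_eq0 => /orP[/eqP|/eqP].
(* Each coordinate is a convex combination of [x i] and [b * x i], hence at most 1 even when
   [b > 1]. *)
move=> _ [t /unit_intervalP/andP[t0 t1] <-]; apply: mahavier_scale_le1 => // [|i].
  by rewrite addr_ge0 ?mulr_ge0// subr_ge0.
have /andP[_ xi] := mahavier_cube Xx i.
have /andP[_ bxi] := mahavier_cube Xbx i; rewrite /scale in bxi.
rewrite mulrDl -mulrA; nra.
Qed.

(** The maximum of [r] and 0, written through the norm to inherit its continuity. *)
Definition pos_part (r : R) : R := (`|r| + r) / 2.

Lemma pos_part_ge0 r : 0 <= r -> pos_part r = r.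
Proof. by move=> r0; rewrite /pos_part ger0_norm//; lra. Qed.

Lemma pos_part_le0 r : r <= 0 -> pos_part r = 0.
Proof. by move=> r0; rewrite /pos_part ler0_norm//; lra. Qed.

Lemma continuous_pos_part_Mr (S : topologicalType) (f : S -> R) (r : R) :
  continuous f -> continuous (fun s => pos_part (f s) * r).
Proof.
move=> cf s; apply: cvgMl; apply: cvgMl; apply: cvgD; last exact: cf.
by apply: cvg_norm; exact: cf.
Qed.

(** The path descends from [x] to the origin and climbs to [y]; positive parts combine both halves
    into one continuous formula. *)
Lemma arc_through_origin x y : X x -> X y -> x <> origin -> y <> origin ->
  (forall b, 0 <= b -> y <> scale b x) ->
  exists2 B, B `<=` X & arc_from_to R B x y.
Proof.
move=> Xx Xy x0 y0 xy.
pose f t : T := fun i => pos_part (1 - 2 * t) * x i + pos_part (2 * t - 1) * y i.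
have f_lo t : t <= 2^-1 -> f t = scale (1 - 2 * t) x.
  move=> t2; apply/funext => i; rewrite /f pos_part_ge0; last lra.
  by rewrite pos_part_le0 ?mul0r ?addr0//; lra.
have f_hi t : 2^-1 <= t -> f t = scale (2 * t - 1) y.
  move=> t2; apply/funext => i; rewrite /f pos_part_le0; last lra.
  by rewrite pos_part_ge0 ?mul0r ?add0r//; lra.
(* A collision between the halves would make [y] a nonnegative multiple of [x]. *)
have mixed s t : s <= 2^-1 -> 2^-1 < t -> f s <> f t.
  move=> s2 t2; rewrite f_lo// f_hi; last exact: ltW.
  have t0 : 0 < 2 * t - 1 by lra.
  move=> /(congr1 (scale (2 * t - 1)^-1)); rewrite !scale_scale mulVf ?gt_eqF// scale1.
  by move=> /esym; apply: xy; apply: mulr_ge0; [rewrite invr_ge0 ltW|lra].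
exists (f @` @unit_interval R); last exists f; first last.
  split; last 2 first.
  - by rewrite f_lo ?invr_ge0// mulr0 subr0 scale1.
  - by rewrite f_hi; [rewrite (_ : 2 * 1 - 1 = 1) ?scale1//; lra|lra].
  apply: compact_inj_homeomorphism; [exact: 0|exact: hausdorff_ptws|
    exact: compact_unit_interval| |].
    apply: continuous_subspaceT; apply: continuous_ptws => i t.
    apply: cvgD.
      apply: (@continuous_pos_part_Mr R (fun t => 1 - 2 * t)) => {}t.
      by apply: cvgB; [exact: cvg_cst|apply: cvgMr; exact: cvg_id].
    apply: (@continuous_pos_part_Mr R (fun t => 2 * t - 1)) => {}t.
    by apply: cvgB; [apply: cvgMr; exact: cvg_id|exact: cvg_cst].
  move=> s t _ _; have [s2|s2] := leP s 2^-1; have [t2|t2] := leP t 2^-1.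
  - by rewrite !f_lo// => /(scale_inj Xx x0); lra.
  - by move=> /mixed; case.
  - by move=> /esym/mixed; case.
  - by rewrite !f_hi ?ltW// => /(scale_inj Xy y0); lra.
move=> _ [t /unit_intervalP t01 <-]; have [t2|t2] := leP t 2^-1.
  by rewrite f_lo//; apply: mahavier_scale => //; lra.
by rewrite f_hi ?ltW//; apply: mahavier_scale => //; lra.
Qed.

Lemma mahavier_arcwise_connected : arcwise_connected R X.
Proof.
move=> x y Xx Xy xy.
have [x0|x0] := pselect (x = origin).
  have [B BX Hyx] : exists2 B, B `<=` X & arc_from_to R B y (scale 0 y).
    apply: arc_along_ray => //; first by rewrite scale0 -x0.
      by apply/eqP; rewrite eq_sym oner_neq0.
    by rewrite -x0 => /esym.
  by exists B => //; rewrite x0 -(scale0 y); exact: arc_from_to_sym.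
have [[b [b0 yb]]|ybN] := pselect (exists b, 0 <= b /\ y = scale b x).
  rewrite yb; apply: arc_along_ray => //; first by rewrite -yb.
  by move=> b1; apply: xy; rewrite yb b1 scale1.
apply: arc_through_origin => // [y0|b b0 yb]; apply: ybN.
  by exists 0; rewrite scale0.
by exists b.
Qed.

(** * Triods *)

(** The legs of the triod, parametrized by the distance to the top; indices from 2 on all denote the
    third one. *)
Definition leg (k : nat) (t : R) : R * R :=
  match k with 0%N => (t, 0) | 1%N => (- t, 0) | _ => (0, t) end.

Lemma triod_modelP (p : R * R) :
  triod_model p <-> exists2 k, (k < 3)%N & exists2 t, 0 <= t <= 1 & p = leg k t.
Proof.
split=> [|[[|[|[|//]]] _ [t t01 ->]]]; rewrite /triod_model/=; last 3 first.
- by left; split=> //; lra.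
- by left; split=> //; lra.
- by right.
case: p => u v /= [[u1 ->]|[-> v1]]; last by exists 2; last exists v.
have [u0|u0] := leP 0 u; first by exists 0; last (exists u => //; lra).
by exists 1; last (exists (- u); rewrite /= ?opprK//; lra).
Qed.

Lemma leg_inj (j k : nat) (s t : R) : (j < 3)%N -> (k < 3)%N -> 0 <= s -> 0 <= t ->
  leg j s = leg k t -> s = t /\ (s = 0 \/ j = k).
Proof.
case: j => [|[|[|//]]] _; case: k => [|[|[|//]]] _ s0 t0 /= [] *; (split; first lra);
  first [by right | left; lra].
Qed.

Lemma leg0 k : leg k 0 = (0, 0).
Proof. by case: k => [|[|k]]; rewrite /= ?oppr0. Qed.

Lemma pair_continuous (f g : R -> R) :
  continuous f -> continuous g -> continuous (fun t => (f t, g t)).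
Proof. by move=> cf cg t; have := cvg_pair (cf t) (cg t); exact. Qed.

Lemma leg_continuous k : continuous (leg k).
Proof.
case: k => [|[|k]].
- by apply: (@pair_continuous id (cst 0)) => t; [exact: cvg_id|exact: cvg_cst].
- by apply: (@pair_continuous -%R (cst 0)) => t; [exact: oppr_continuous|exact: cvg_cst].
- by apply: (@pair_continuous (cst 0) id) => t; [exact: cvg_cst|exact: cvg_id].
Qed.

Lemma leg_sub k : (k < 3)%N -> leg k @` `[0, 1]%classic `<=` @triod_model R.
Proof.
move=> k3 _ [t + <-]; rewrite /= in_itv => t01.
by apply/triod_modelP; exists k => //; exists t.
Qed.

Lemma leg_compact k : compact (leg k @` `[0, 1]%classic).
Proof.
apply: continuous_compact; last exact: segment_compact.
by apply: continuous_subspaceT; exact: leg_continuous.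
Qed.

Lemma leg_connected k : connected (leg k @` `[0, 1]%classic).
Proof.
apply: connected_continuous_connected; first exact: normed_module.segment_connected.
by apply: continuous_subspaceT; exact: leg_continuous.
Qed.

Lemma triod_model_compact : compact (@triod_model R).
Proof.
pose L k := leg k @` `[0, 1]%classic.
rewrite (_ : @triod_model R = L 0%N `|` L 1%N `|` L 2%N).
  by do 2?apply: compactU; exact: leg_compact.
apply/seteqP; split=> [_ /triod_modelP[k k3 [t t01 ->]]|p [[|]|]]; try exact: leg_sub.
have Lk : L k (leg k t) by exists t; rewrite //= in_itv.
by case: k k3 Lk => [|[|[|//]]] _ Lk; [left; left|left; right|right].
Qed.

(* Two of the three legs of a triod would leave v on the same side. *)
Lemma triod_top_origin Y v : Y `<=` X -> simple_triod_with_top R Y v -> v = origin.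
Proof.
move=> YX [f [Hf f0]]; apply: contrapT => v0.
have Xv : X v.
  rewrite -f0; apply: YX; case: Hf => + _ _; apply; apply/triod_modelP.
  by exists 0 => //; exists 0; rewrite //= lexx ler01.
have leg_side k : (k < 3)%N -> exists s, side v s (f @` (leg k @` `[0, 1]%classic)).
  move=> k3.
  have [CX clC cC] := homeomorphism_image_closed_connected Hf YX (leg_sub k3)
    (@leg_compact k) (@leg_connected k).
  have I0 : `[0, 1]%classic (0 : R) by rewrite /= in_itv/= lexx ler01.
  have I1 : `[0, 1]%classic (1 : R) by rewrite /= in_itv/= lexx ler01.
  apply: (side_exists (z := f (leg k 1))) => //.
  - by exists (leg k 0); [exists 0|rewrite leg0].
  - by exists (leg k 1) => //; exists 1.
  - rewrite -f0 -(leg0 k) => e.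
    have /(leg_inj k3 k3 ler01 (lexx 0))[/eqP] : leg k 1 = leg k 0.
      by apply: (homeomorphism_inj Hf _ _ e); apply: (leg_sub k3); [exists 1|exists 0].
    by rewrite oner_eq0.
have disj j k s : (j < 3)%N -> (k < 3)%N -> j <> k ->
    side v s (f @` (leg j @` `[0, 1]%classic)) ->
    side v s (f @` (leg k @` `[0, 1]%classic)) -> False.
  move=> j3 k3 jk sj sk.
  have [y yv [[p pj fp] [q qk fq]]] := side_meet Xv v0 sj sk.
  have pq : p = q.
    by apply: (homeomorphism_inj Hf); [exact: (leg_sub j3)|exact: (leg_sub k3)|rewrite fp].
  case: pj qk => a + ap [b + bq]; rewrite /= !in_itv/= => /andP[a0 _] /andP[b0 _].
  have [] : a = b /\ (a = 0 \/ j = k) by apply: leg_inj => //; rewrite ap bq.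
  move=> _ [a00|//]; apply: yv.
  by rewrite -fp -ap a00 leg0.
(* Three legs and two sides: two legs share a side. *)
have [s0 S0] := leg_side 0 isT; have [s1 S1] := leg_side 1%N isT.
have [s2 S2] := leg_side 2%N isT.
have [e|/eqP n01] := eqVneq s0 s1; first by rewrite -e in S1; exact: (@disj 0%N 1%N s0).
have [e|/eqP n02] := eqVneq s0 s2; first by rewrite -e in S2; exact: (@disj 0%N 2%N s0).
have e : s1 = s2 by case: s0 s1 s2 n01 n02 {S0 S1 S2} => -[] [].
by rewrite -e in S2; exact: (@disj 1%N 2%N s1).
Qed.

(** Segments in three different directions meet only at the origin, so mapping each leg linearly
    onto one of them is injective. *)
Lemma triod_exists (P : nat -> T) : (forall k, X (P k)) -> (forall k, P k <> origin) ->
  (forall j k b, j <> k -> 0 <= b -> P j <> scale b (P k)) ->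
  exists2 Y, Y `<=` X & simple_triod_with_top R Y origin.
Proof.
move=> XP P0 Pinc.
pose f (p : R * R) : T := fun i =>
  pos_part p.1 * P 0%N i + pos_part (- p.1) * P 1%N i + pos_part p.2 * P 2%N i.
have fleg k t : (k < 3)%N -> 0 <= t -> f (leg k t) = scale t (P k).
  move=> + t0; have t0' : - t <= 0 by lra.
  case: k => [|[|[|//]]] _; apply/funext => i; rewrite /f /scale /= ?opprK ?oppr0;
    by rewrite (pos_part_ge0 t0) ?(pos_part_le0 t0') ?(pos_part_ge0 (lexx 0)); lra.
exists (f @` @triod_model R).
  move=> _ [p /triod_modelP[k k3 [t t01 ->]] <-]; rewrite fleg//; last by case/andP: t01.
  exact: mahavier_scale.
exists f; split; last by rewrite -(leg0 0) fleg// scale0.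
apply: compact_inj_homeomorphism;
  [exact: (0, 0)|exact: hausdorff_ptws|exact: triod_model_compact| |].
  apply: continuous_subspaceT; apply: continuous_ptws => i p.
  apply: cvgD; first apply: cvgD.
  - by apply: (@continuous_pos_part_Mr _ (fun p : R * R => p.1)) => {}p; exact: cvg_fst.
  - apply: (@continuous_pos_part_Mr _ (fun p : R * R => - p.1)) => {}p.
    by apply: cvgN; exact: cvg_fst.
  - by apply: (@continuous_pos_part_Mr _ (fun p : R * R => p.2)) => {}p; exact: cvg_snd.
move=> c d /set_mem/triod_modelP[j j3 [s /andP[s0 _] ->]].
move=> /set_mem/triod_modelP[k k3 [t /andP[t0 _] ->]].
rewrite !fleg// => e.
have [jk|jk] := eqVneq j k; first by rewrite -jk in e *; rewrite (scale_inj (XP j) (P0 j) e).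
(* A point common to two different rays must be the origin. *)
have degenerate l m a b : l <> m -> 0 <= a -> 0 <= b -> scale a (P l) = scale b (P m) -> a = 0.
  move=> lm a0 b0 ab; apply/eqP; rewrite -[_ == _]negbK; apply/negP => an.
  apply: (Pinc l m (a^-1 * b)) => //; first by rewrite mulr_ge0// invr_ge0.
  by rewrite -scale_scale -ab scale_scale mulVf// scale1.
have -> : s = 0 by apply: degenerate e => //; exact/eqP.
have -> : t = 0 by apply: degenerate (esym e) => //; apply/eqP; rewrite eq_sym.
by rewrite !leg0.
Qed.

(** * Ramification at the origin *)

Variables p q : R.
Hypotheses (Op : p \in Omega) (Oq : q \in Omega) (p1 : p < 1) (q1 : 1 < q).

(** Climbs with ratio [q] to its maximum 1 at index 0, then descends with ratio [p]; its shifts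
    supply distinct directions. *)
Definition peak : T := fun i =>
  match i with Posz k => p ^+ k | Negz k => q^-1 ^+ k.+1 end.

Definition shift (n : nat) x : T := fun i => x (i - n%:Z).

Lemma peak_step i : peak (i + 1) = (if 0 <= i then p else q) * peak i.
Proof.
have q0 : q != 0 by rewrite gt_eqF// (lt_trans ltr01).
case: i => k.
  by rewrite (_ : Posz k + 1 = Posz k.+1)/=; [rewrite exprS|lia].
rewrite /=; case: k => [|k].
  by rewrite (_ : Negz 0 + 1 = 0)//= expr0 expr1 mulfV.
rewrite (_ : Negz k.+1 + 1 = Negz k); last by rewrite !NegzE; lia.
by rewrite /= [in RHS]exprS mulVKf.
Qed.

Lemma peak_gt0 i : 0 < peak i.
Proof.
case: i => k; rewrite /= exprn_gt0 ?invr_gt0//; exact: Omega_gt0.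
Qed.

Lemma mahavier_shift n x : X x -> X (shift n x).
Proof.
move=> /mahavierP[Qx Fx]; apply/mahavierP; split=> i; first exact: Qx.
by have [w Ow e] := Fx (i - n%:Z); exists w => //; rewrite /shift -e addrAC.
Qed.

Lemma mahavier_peak : X peak.
Proof.
apply/mahavierP; split=> i; last first.
  rewrite peak_step; case: ifP => _; [by exists p|by exists q].
rewrite (ltW (peak_gt0 i))/=; case: i => k /=.
  by apply: exprn_ile1; rewrite ?ltW// Omega_gt0.
by apply: exprn_ile1; rewrite ?invr_ge0 ?invf_le1 ?ltW ?Omega_gt0.
Qed.

Lemma shift_peak_neq0 n : shift n peak <> origin.
Proof. by move=> /(congr1 (@^~ 0)) /eqP; rewrite gt_eqF// peak_gt0. Qed.

(** Scaling preserves ratios, and at index [minn j k] one of the two shifts has already switched to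
    ratio [p] while the other still has ratio [q]. *)
Lemma shift_peak_incomparable j k b : j <> k -> shift j peak <> scale b (shift k peak).
Proof.
move=> jk e.
have step i : shift j peak (i + 1) = (if k%:Z <= i then p else q) * shift j peak i.
  rewrite e /scale /shift addrAC peak_step subr_ge0 mulrCA//.
have := step (minn j k)%:Z.
rewrite {1}/shift addrAC peak_step subr_ge0 -/(shift j peak (minn j k)%:Z).
move=> /(mulIf (lt0r_neq0 (peak_gt0 _))).
have pq : p <> q by move=> pq; have := lt_trans p1 q1; rewrite pq ltxx.
by case: ifP => jm; case: ifP => km e';
  first [exact: (pq e') | exact: (pq (esym e')) | apply: jk; lia].
Qed.

Lemma mahavier_ramification_points : ramification_points R X = [set origin].
Proof.
apply/seteqP; split=> [v [Y YX /(triod_top_origin YX)]//|_ ->].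
apply: (@triod_exists (fun k => shift k peak)) => [k|k|j k b jk _].
- exact/mahavier_shift/mahavier_peak.
- exact: shift_peak_neq0.
- exact: shift_peak_incomparable.
Qed.

Lemma mahavier_smooth_fan : smooth_fan (@dist R) X.
Proof.
split; last by move=> v; rewrite mahavier_ramification_points => ->; exact: mahavier_smooth.
split.
- split; first by exists peak; exact: mahavier_peak.
  + exact: compatible_metric_dist mahavier_cube.
  + exact: mahavier_compact.
  + exact: mahavier_connected.
- exact: mahavier_arcwise_connected.
- exact: mahavier_hereditarily_unicoherent.
- by exists origin; exact: mahavier_ramification_points.
Qed.

(** * Density of the endpoints *)

Hypothesis pq_indep : forall k l : nat, p ^+ k * q ^+ l = 1 -> k = 0%N /\ l = 0%N.

(* The j-th term of the path starting at 1 that makes k steps p, then l steps q,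
   then steps p forever. *)
Definition detour (k l j : nat) : R :=
  p ^+ (j - minn (j - k) l) * q ^+ minn (j - k) l.

Lemma detour0 k l : detour k l 0 = 1.
Proof. by rewrite /detour sub0n min0n mulr1. Qed.

Lemma detour_end k l : detour k l (k + l) = p ^+ k * q ^+ l.
Proof. by rewrite /detour addKn minnn addnK. Qed.

Lemma detour_gt0 k l j : 0 < detour k l j.
Proof. by rewrite mulr_gt0// exprn_gt0// Omega_gt0. Qed.

Lemma detour_step k l j :
  exists2 w, w \in Omega & detour k l j.+1 = w * detour k l j.
Proof.
rewrite /detour; have [jk|kj] := ltnP j k.
  exists p => //; have -> : (j.+1 - k = 0)%N by lia.
  have -> : (j - k = 0)%N by lia.
  by rewrite min0n !subn0 exprS mulrA.
have [jl|lj] := ltnP (j - k) l.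
  exists q => //; have -> : (minn (j.+1 - k) l = (j - k).+1)%N by lia.
  by rewrite subSS (exprS q) mulrCA.
exists p => //; have -> : (minn (j.+1 - k) l = l)%N by lia.
have -> : (j.+1 - l = (j - l).+1)%N by lia.
by rewrite exprS mulrA.
Qed.

(** The path falls from 1, climbs to [p ^+ k * q ^+ l], then falls again, so its maximum is at the
    start or at the end of the climb. *)
Lemma detour_le k l j : detour k l j <= Num.max 1 (p ^+ k * q ^+ l).
Proof.
have p_ge0 : 0 <= p by rewrite ltW// Omega_gt0.
have q_ge0 : 0 <= q by rewrite ltW// Omega_gt0.
rewrite /detour le_max; have [jk|kj] := ltnP j k.
  have -> : (j - k = 0)%N by lia.
  by rewrite min0n mulr1 subn0 exprn_ile1// ltW.
apply/orP; right; apply: ler_pM; rewrite ?exprn_ge0//.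
  by apply: ler_wiXn2l => //; [exact: ltW|lia].
by apply: ler_weXn2l; [exact: ltW|exact: geq_minr].
Qed.

Definition graft (n k l : nat) x : T := fun i =>
  if i <= n%:Z then x i else x n * detour k l `|i - n%:Z|.

Lemma graft_left n k l x i : i <= n%:Z -> graft n k l x i = x i.
Proof. by rewrite /graft => ->. Qed.

Lemma graft_right n k l x (j : nat) : graft n k l x (n%:Z + j%:Z) = x n * detour k l j.
Proof.
rewrite /graft; case: ifP => [h|_]; last by congr (_ * detour _ _ _); lia.
have -> : j = 0%N by lia.
by rewrite addr0 detour0 mulr1.
Qed.

Lemma int_le_or_add (n : nat) (i : int) :
  (i <= n%:Z) \/ exists j : nat, i = n%:Z + j%:Z.
Proof.
have [h|h] := leP i n%:Z; [by left|right; exists `|i - n%:Z|%N; lia].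
Qed.

Lemma graft_step n k l x i : X x ->
  exists2 w, w \in Omega & graft n k l x (i + 1) = w * graft n k l x i.
Proof.
move=> /mahavierP[Qx Fx]; have [h|h] := ltP i n%:Z.
  have [w Ow e] := Fx i; exists w => //; rewrite !graft_left//; lia.
have [j ->] : exists j : nat, i = n%:Z + j%:Z by exists `|i - n%:Z|%N; lia.
have [w Ow e] := detour_step k l j; exists w => //.
have -> : n%:Z + j%:Z + 1 = n%:Z + j.+1%:Z by lia.
by rewrite !graft_right e mulrCA.
Qed.

(* The detour brings the coordinates close to 1 while they stay below their
   final value, which is then normalized to 1. *)
Lemma tip_near x m e : X x -> x <> origin -> m < 1 -> (forall i, x i <= m) -> 0 < e ->
  exists2 y, tip y & dist x y < e.
Proof.
move=> Xx x0 m1 xm e0; have Qx := mahavier_cube Xx.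
have [n nP] := dist_lt_window e0.
have xn : 0 < x n by exact: mahavier_neq0.
have e21 : 0 < 1 + e / 2 by lra.
(* Exceeding [m] makes the final value [Y] dominate all coordinates of [x]; exceeding
   [(1 + e / 2)^-1] makes the rescaling by [Y^-1] move points by less than [e / 2]. *)
have b1 : Num.max m (1 + e / 2)^-1 < 1 by rewrite gt_max m1 invf_lt1//; lra.
have [k [l]] := monomials_reach (Omega_gt0 Op) p1 q1 pq_indep xn b1.
set Y := x n * _; rewrite gt_max => /andP[/andP[mY eY] Y1].
have Y0 : 0 < Y by apply: lt_trans eY; rewrite invr_gt0.
pose y := graft n k l x.
have y_ge0 i : 0 <= y i.
  have [h|[j ->]] := int_le_or_add n i; first by rewrite /y graft_left// mahavier_ge0.
  by rewrite /y graft_right mulr_ge0// ltW// detour_gt0.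
have yY i : y i <= Y.
  have [h|[j ->]] := int_le_or_add n i.
    by rewrite /y graft_left// (le_trans (xm i))// ltW.
  have := detour_le k l j; rewrite /y graft_right le_max => /orP[d|d].
    by rewrite (le_trans _ (le_trans (xm n) (ltW mY)))// ler_piMr// ltW.
  by rewrite /Y ler_pM2l.
have Xy : X (scale Y^-1 y).
  apply/mahavierP; split=> i.
    by rewrite /scale mulr_ge0 ?invr_ge0 ?(ltW Y0)//= -ler_pdivlMl ?invr_gt0// invrK mulr1.
  have [w Ow yi] := graft_step n k l i Xx; exists w => //.
  by rewrite /scale /y yi mulrCA.
exists (scale Y^-1 y).
  (* At index [n + k + l], the end of the climb, the rescaled coordinate is exactly 1. *)
  split=> // m' m'1; exists (n%:Z + (k + l)%N%:Z).
  by rewrite /scale /y graft_right detour_end -/Y mulVf// gt_eqF.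
apply: nP => // [|i iN]; first exact: mahavier_cube.
have i_le : i <= n%:Z by move: iN; clear; lia.
rewrite /scale /y graft_left// -[X in X - _]mul1r -mulrBl normrM (ger0_norm (mahavier_ge0 i Xx)).
have YV1 : 1 <= Y^-1 by rewrite invf_ge1// ltW.
have YVe : Y^-1 < 1 + e / 2 by rewrite -[ltRHS]invrK ltf_pV2 ?posrE ?invr_gt0.
have /andP[xi0 xi1] := Qx i.
rewrite distrC ger0_norm ?subr_ge0//.
apply: (@le_trans _ _ (Y^-1 - 1)); last lra.
by rewrite ler_piMr// subr_ge0.
Qed.

Lemma tips_dense x e : X x -> 0 < e -> exists2 y, tip y & dist x y < e.
Proof.
move=> Xx e0.
have [tx|ntx] := pselect (tip x).
  exists x => //; have /compatible_metric_dist[_ dd _ _ _] := @mahavier_cube.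
  by rewrite (dd x x Xx Xx).2.
have [x0|x0] := pselect (x = origin); last first.
  have [m m1 xm] : exists2 m : R, m < 1 & forall i, x i <= m.
    apply: contrapT => H; apply: ntx; split=> // m m1; apply: contrapT => xm.
    apply: H; exists m => // i; rewrite leNgt; apply/negP => mi.
    by apply: xm; exists i.
  exact: tip_near xm e0.
(* The origin has no positive coordinate to start a detour from; a small multiple of [peak], within
   [e / 2] of it and bounded by [d < 1], takes its place. *)
pose d := Num.min 2^-1 (e / 2).
have d0 : 0 < d by rewrite lt_min invr_gt0 ltr0n divr_gt0.
have d1 : d < 1 by rewrite gt_min invf_lt1 ?ltr1n.
have de : d <= e / 2 by rewrite ge_min lexx orbT.
have Xd : X (scale d peak) by apply: mahavier_scale; [exact: mahavier_peak|rewrite !ltW].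
have Qp := mahavier_cube mahavier_peak.
have [|||y ty dy] := @tip_near (scale d peak) d (e / 2) Xd _ d1.
- move=> /(congr1 (@^~ 0))/eqP; rewrite /scale mulf_eq0 !gt_eqF//; exact: peak_gt0.
- by move=> i; have /andP[_ ?] := Qp i; rewrite /scale ler_piMr// ltW.
- by rewrite divr_gt0.
exists y => //; have [Xy _] := ty.
have /compatible_metric_dist[_ _ _ tri _] := @mahavier_cube.
apply: le_lt_trans (tri x (scale d peak) y Xx Xd Xy) _.
have : dist x (scale d peak) <= d.
  apply/dist_leP => [||i]; [exact: mahavier_cube|exact: mahavier_cube|].
  have /andP[? ?] := Qp i.
  have -> : `|x i - scale d peak i| = d * peak i.
    by rewrite x0 sub0r normrN ger0_norm// mulr_ge0// ltW.
  by rewrite ler_pM2l// (@le_trans _ _ 1)// ler1n.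
lra.
Qed.

Lemma mahavier_Lelek_fan : Lelek_fan R X.
Proof.
exists (@dist R); split; first exact: mahavier_smooth_fan.
move=> x Xx U xU; have Qx := mahavier_cube Xx.
have [e e0 eU] := nbhs_dist_lt Qx xU.
have [y ty xy] := tips_dense Xx e0.
exists y; split; first exact: tip_endpoint.
by apply: eU => //; apply: mahavier_cube; case: ty.
Qed.

End Fan.

Theorem theorem4p14 (R : realType) (M : nat) (Omega : M.-tuple R)
  (hOmega : LF_inducing Omega) :
  Lelek_fan R (mahavier_product (@unit_interval R) (F_of Omega)).
Proof.
have [M2 Omega_gt0 /andP[p1 q1] [/andP[p0 _] _ nc]] := hOmega.
have Op : Omega`_0 \in Omega by rewrite mem_nth// size_tuple (leq_trans _ M2).
have Oq : Omega`_1 \in Omega by rewrite mem_nth// size_tuple.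
apply: (mahavier_Lelek_fan Omega_gt0 Op Oq p1 q1) => k l pq1.
have q0 : 0 < Omega`_1 by exact: Omega_gt0.
(* The equation [p ^+ k * q ^+ l = 1] is read as an equality of the integer powers with exponents
   [k] and [- l]. *)
have [] := (nc k%:Z (- l%:Z)).1 => [|k0 l0]; last by split; lia.
rewrite -exprnN -exprnP; apply: (mulIf (lt0r_neq0 (exprn_gt0 l q0))).
by rewrite pq1 mulVf// gt_eqF// exprn_gt0.
Qed.
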